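(* Let $\mathcal{H}$ be a real separable Hilbert space, let $C$ be a nonempty closed convex subset of $\mathcal{H}$, let $\kappa>0$, and let $g\in\Gamma_0(\mathcal{H})$ be differentiable on $\mathcal{H}$ with a $\beta$-Lipschitz continuous gradient, where $\beta\in\,]0,+\infty[$. Let $(\gamma_n)_{n\in\mathbb{N}}$ be a real sequence and $\underline{\gamma},\overline{\gamma}$ be reals such that $0<\underline{\gamma}\le\gamma_n\le\overline{\gamma}<2\kappa^{-1}\beta^{-1}$ for every $n\in\mathbb{N}$, and let $(\lambda_n)_{n\in\mathbb{N}}$ and $\underline{\lambda}$ be such that $0<\underline{\lambda}\le\lambda_n\le1$ for every $n\in\mathbb{N}$. Let $x\in\mathcal{H}$, $x_0\in\mathcal{H}$ and, for every $n\in\mathbb{N}$, $$x_{n+1}=x_n+\lambda_n\left(P_C\Big(\frac{x_n-\gamma_n(\kappa\nabla g(x_n)-x)}{1+\gamma_n}\Big)-x_n\right).$$ Then: (i) for every $n\in\mathbb{N}$, $$\|x_n-\operatorname{prox}_{\iota_C+\kappa g}x\|\le\rho^n\|x_0-\operatorname{prox}_{\iota_C+\kappa g}x\|,\qquad\text{where }\rho=1-\frac{\underline{\lambda}\,\underline{\gamma}}{1+\underline{\gamma}};$$ (ii) if $x_0=\operatorname{prox}_{\kappa g}x$, then $$\operatorname{prox}_{\kappa g}x\in C\quad\Rightarrow\quad(\forall n\in\mathbb{N})\;\;x_n=\operatorname{prox}_{\iota_C+\kappa g}x.$$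
   Context: $\Gamma_0(\mathcal{H})$ denotes the class of lower semicontinuous convex functions from $\mathcal{H}$ to $]-\infty,+\infty]$ that are proper (not identically $+\infty$). $\iota_C$ is the indicator function of $C$ ($0$ on $C$, $+\infty$ elsewhere), $P_C$ is the projection onto $C$, and for $h\in\Gamma_0(\mathcal{H})$, $\operatorname{prox}_h x=\arg\min_{y\in\mathcal{H}}\frac12\|y-x\|^2+h(y)$. *)

(* Defs.v *)
From HB Require Import structures.
From mathcomp Require Export all_boot all_order all_algebra.
From mathcomp Require Export all_classical all_reals all_analysis.

Set Implicit Arguments.
Unset Strict Implicit.
Unset Printing Implicit Defensive.

Import Order.TTheory GRing.Theory Num.Theory.
Import numFieldNormedType.Exports.

Local Open Scope classical_set_scope.
Local Open Scope ring_scope.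

Definition separable_space (T : topologicalType) : Prop :=
  exists2 D : set T, countable D & dense D.

Section ConvexAnalysis.
Context {R : realType} {H : completeNormedModType R}.
Implicit Types (C : set H) (f g h : H -> \bar R) (x y z : H).

(* With the library convention 0 * +oo = 0, the endpoint cases t = 0 and t = 1
   hold trivially. *)
Definition econvex f : Prop :=
  forall x y (t : R), 0 <= t <= 1 ->
    (f (t *: x + (1 - t) *: y)%R <= t%:E * f x + (1 - t)%:E * f y)%E.

Definition Gamma0 f : Prop :=
  [/\ (forall x, f x != -oo%E),
      (exists x, f x != +oo%E),
      econvex f &
      lower_semicontinuous f].

Definition indicator C : H -> \bar R :=
  fun y => if `[< C y >] then 0%E else +oo%E.

(* P_C: the nearest point of C, which exists and is unique for C nonempty,
   closed and convex in a Hilbert space (the value 0 is a dummy otherwise). *)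
Definition proj C x : H :=
  xget 0 [set p | C p /\ forall q, C q -> `|x - p| <= `|x - q|].

Definition argmin f : set H := [set p | forall q, (f p <= f q)%E].

(* The minimizer exists and is unique for h in Gamma0 on a Hilbert space
   (the value 0 is a dummy otherwise). *)
Definition prox h x : H :=
  xget 0 (argmin (fun y => (2^-1 * `|y - x| ^+ 2)%:E + h y)%E).

(* Frechet differentiability at z of an extended-real-valued function, which
   entails finiteness on a neighborhood of z. *)
Definition ediff_at f z : Prop :=
  (\forall y \near z, f y \is a fin_num) /\ differentiable (fine \o f) z.

(* The Riesz representative of the differential of f at z. *)
Definition gradient (dot : {dot H for @idfun R}) f z : H :=
  xget 0 [set v | forall u, 'd (fine \o f) z u = dot u v].

End ConvexAnalysis.

(* Main.v *)
Require Import Defs.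
From mathcomp Require Import ring lra.

Set Implicit Arguments.
Unset Strict Implicit.
Unset Printing Implicit Defensive.

Import Order.TTheory GRing.Theory Num.Theory.
Import numFieldNormedType.Exports.

Local Open Scope classical_set_scope.
Local Open Scope ring_scope.

(** The iteration is a relaxed forward-backward step for the strongly convex
objective y |-> 1/2 |y - x|^2 + kappa g(y) + iota_C(y); it contracts because
the quadratic term is treated inside the resolvent.

Write f = kappa g, with gradient G, which is Lipschitz with constant
b = kappa beta.  The minimizer p is the point of C with
<q - p, (x - G p) - p> <= 0 for all q in C, that is, the projection of x - G p
onto C.  Hence p is also the projection onto C of
(1 + s)^-1 (p - s (G p - x)) for every s > 0, the same expression which
the algorithm evaluates at x_n with s = gamma_n.  Since s b <= 2, the map
y |-> y - s G y is nonexpansive, so the projection step brings the distance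
to p down by a factor (1 + s)^-1 ([forward_backward_contraction]); relaxation by
lambda_n and monotonicity in s turn this factor into rho
([relaxed_contraction]), and (i) follows by induction.  For (ii), if
the unconstrained minimizer lies in C, it is the constrained minimizer by
uniqueness, so x_0 = p and the bound in (i) vanishes.

Three classical ingredients have to be established along the way.
- Existence of minimizers of f + 1/2 |. - x|^2 over a closed convex set, for f
  continuous, midpoint convex and of at most linear decrease
  ([prox_objective_argmin_ex]): almost-minimizers form a Cauchy filter, by the
  parallelogram law.  This single result gives the projection onto C, the
  proximal points, and the Riesz representation theorem (take f to be the opposite
  of the linear form), which in turn gives the gradient its meaning.
- The bracket f(x) + <G x, y - x> <= f(y) <= f(x) + <G x, y - x> + b/2 |y - x|^2
  ([smooth_convex]): the lower bound is convexity, the upper bound is the descent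
  lemma, obtained by differentiating f along a segment.  Apart from continuity,
  the rest of the argument uses f through this bracket alone, so that the
  projection is just the case f = 0.
- The Baillon-Haddad inequality |G y - G x|^2 <= b <G y - G x, y - x>
  ([gradient_cocoercive]), which is what makes y |-> y - s G y nonexpansive all
  the way up to s b = 2. *)

(** * Scalars and convex sets *)

(** A first-order optimality test without limits: if a were negative, the choice
t = - a / (|b| - a) would make the quadratic negative. *)
Lemma ge0_of_quadratic_ge0 (R : realFieldType) (a b : R) :
  (forall t, 0 < t <= 1 -> 0 <= t * a + t ^+ 2 * b) -> 0 <= a.
Proof.
move=> quad_ge0; rewrite leNgt; apply/negP => a_lt0.
pose t := - a / (`|b| - a).
have := normr_ge0 b; have := ler_norm b => b_le n_ge0.
have d_gt0 : 0 < `|b| - a by lra.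
have t_gt0 : 0 < t by rewrite divr_gt0 ?oppr_gt0.
have t_le1 : t <= 1 by rewrite ler_pdivrMr//; lra.
have tE : t * (`|b| - a) = - a by rewrite divfK ?gt_eqF.
have := quad_ge0 t; rewrite t_gt0 t_le1 => /(_ isT).
have -> : t * a + t ^+ 2 * b = t * (a + t * b) by ring.
rewrite pmulr_rge0// => ab_ge0.
have : t * b <= t * `|b| by rewrite ler_pM2l.
have : 0 < t * - a by rewrite mulr_gt0 ?oppr_gt0.
lra.
Qed.

Lemma convex_set_segment (R : realType) (M : lmodType R) (C : set M) :
  convex_set C -> forall p q (t : R), C p -> C q -> 0 <= t <= 1 ->
  C (p + t *: (q - p)).
Proof.
move=> C_convex p q t Cp Cq /andP[t_ge0 t_le1].
have t01 : Itv.spec (@Itv.num_sem R) (Itv.Real `[0%Z, 1%Z]) t.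
  by rewrite /= /Itv.num_sem/= num_real/= in_itv/= t_ge0 t_le1.
have /set_mem := C_convex q p (Itv.mk t01) (mem_set Cq) (mem_set Cp).
rewrite /conv/= /conv/= => Cm.
suff -> : p + t *: (q - p) = t *: q + (1 - t) *: p by [].
by rewrite scalerBr scalerBl scale1r addrCA.
Qed.

Lemma convex_setT (R : realType) (M : lmodType R) : @convex_set R M setT.
Proof. by move=> p q t _ _; rewrite inE. Qed.

(** * Differentiable functions along a segment *)

Section Calculus.
Context {R : realType} {H : normedModType R}.
Implicit Types (x y z h : H) (f : H -> R).

(** Convexity bounds the difference quotients (f(x + t (y - x)) - f x) / t by
f y - f x for 0 < t < 1; let t tend to 0 from the right. *)
Lemma convex_above_tangent f x y :
  (forall t, 0 <= t <= 1 -> f (t *: y + (1 - t) *: x) <= t * f y + (1 - t) * f x) ->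
  differentiable f x -> f x + 'd f x (y - x) <= f y.
Proof.
move=> f_conv f_diff; rewrite -lerBrDl -deriveE//.
have f_cvg := cvg_dnbhs_at_right (diff_derivable (v := y - x) f_diff).
apply: (cvgr_to_le f_cvg); near=> t.
have t_gt0 : 0 < t by [].
have t01 : 0 <= t <= 1 by rewrite !ltW//=; near: t; exact: nbhs_right_lt.
rewrite /GRing.scale/= ler_pdivrMl//.
have -> : t *: (y - x) + x = t *: y + (1 - t) *: x.
  by rewrite scalerBr scalerBl scale1r -addrA [- _ + x]addrC.
have := f_conv _ t01; lra.
Unshelve. all: by end_near.
Qed.

Lemma is_derive_along_line f x h (t : R) : differentiable f (x + t *: h) ->
  is_derive t 1 (fun s : R => f (x + s *: h)) ('d f (x + t *: h) h).
Proof.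
move=> f_diff.
have line_diff : is_diff t (fun s : R => x + s *: h) (fun s : R => s *: h).
  have : is_diff t (cst x + *:%R^~ h) (0 + *:%R^~ h) by exact: is_diffD.
  by rewrite add0r.
have line_differentiable : differentiable (fun s : R => x + s *: h) t.
  exact: ex_diff.
have fline_diff := differentiable_comp line_differentiable f_diff.
apply: DeriveDef; first exact: diff_derivable.
by rewrite deriveE// diff_comp//= diff_val scale1r.
Qed.

End Calculus.

(** * Minimizers of quadratically regularized functions *)

Section InnerProduct.
Context {R : realType} {H : completeNormedModType R}.
Variable dot : {dot H for @idfun R}.
Hypothesis dot_norm : forall u : H, dot u u = `|u| ^+ 2.
Implicit Types (u v w x y z p q : H) (C : set H) (f : H -> R) (G : H -> H).

Lemma dotC u v : dot u v = dot v u.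
Proof. by rewrite hermC expr0 mul1r. Qed.

Lemma dotDl u v w : dot (u + v) w = dot u w + dot v w.
Proof. exact: linearDl. Qed.

Lemma dotDr u v w : dot u (v + w) = dot u v + dot u w.
Proof. exact: linearDr. Qed.

Lemma dotNl u v : dot (- u) v = - dot u v.
Proof. exact: linearNl. Qed.

Lemma dotNr u v : dot u (- v) = - dot u v.
Proof. exact: linearNr. Qed.

Lemma dotZl (k : R) u v : dot (k *: u) v = k * dot u v.
Proof. exact: linearZl_LR. Qed.

Lemma dotZr (k : R) u v : dot u (k *: v) = k * dot u v.
Proof. exact: linearZr_LR. Qed.

Definition dotE := (dotDl, dotDr, dotNl, dotNr, dotZl, dotZr).

(** Cauchy-Schwarz, read off from the triangle inequality for u + v, which is
already part of the norm structure. *)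
Lemma dot_le_norm u v : dot u v <= `|u| * `|v|.
Proof.
have : `|u + v| ^+ 2 <= (`|u| + `|v|) ^+ 2.
  by rewrite lerXn2r ?nnegrE ?addr_ge0// ler_normD.
rewrite -dot_norm !dotE !dot_norm (dotC v u) => ?.
nra.
Qed.

Definition prox_objective f x y : R := 2^-1 * `|y - x| ^+ 2 + f y.

(** Convexity tested at midpoints only, which is all that the parallelogram law
uses; the midpoint is written as a point of the segment, to match
[convex_set_segment]. *)
Definition midpoint_convex f :=
  forall p q, f (p + 2^-1 *: (q - p)) <= (f p + f q) / 2.

(** Strong convexity of the objective: the parallelogram law yields the
quadratic gain, which is behind both existence and uniqueness of minimizers. *)
Lemma prox_objective_midpoint f x p q : midpoint_convex f ->
  prox_objective f x (p + 2^-1 *: (q - p)) <=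
  (prox_objective f x p + prox_objective f x q) / 2 - 8^-1 * `|p - q| ^+ 2.
Proof.
move=> /(_ p q); rewrite /prox_objective.
set m := p + _.
have -> : `|m - x| ^+ 2 =
    (`|p - x| ^+ 2 + `|q - x| ^+ 2) / 2 - 4^-1 * `|p - q| ^+ 2.
  rewrite -!dot_norm /m !dotE (dotC q p) (dotC x p) (dotC x q).
  by field.
lra.
Qed.

Lemma prox_objective_argmin_unique f C x p q :
  midpoint_convex f -> convex_set C ->
  C p -> (forall y, C y -> prox_objective f x p <= prox_objective f x y) ->
  C q -> (forall y, C y -> prox_objective f x q <= prox_objective f x y) ->
  p = q.
Proof.
move=> f_mid C_convex Cp p_min Cq q_min.
have Cm : C (p + 2^-1 *: (q - p)) by apply: convex_set_segment => //; lra.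
have := prox_objective_midpoint x p q f_mid.
have := p_min _ Cm; have := q_min _ Cp => le_qp le_pm le_m.
have : `|p - q| ^+ 2 <= 0 by lra.
rewrite le_eqVlt ltNge sqr_ge0 orbF sqrf_eq0 normr_eq0 subr_eq0.
by move/eqP.
Qed.

(** The sets of e-almost minimizers in C generate a filter; by
[prox_objective_midpoint] two such points are at distance at most
(8 e)^(1/2), so the filter is Cauchy, and its limit is a minimizer because C is
closed and f is continuous.  The lower bound on f, of linear growth, serves to
keep the infimum finite. *)
Lemma prox_objective_argmin_ex f C x (a M : R) :
  C !=set0 -> closed C -> convex_set C ->
  midpoint_convex f -> continuous f -> (forall y, a - M * `|y - x| <= f y) ->
  exists2 p, C p & forall q, C q -> prox_objective f x p <= prox_objective f x q.
Proof.
move=> [c Cc] C_closed C_convex f_mid f_cont f_ge.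
pose phi := prox_objective f x.
have phi_cont : continuous phi.
  move=> y; apply: cvgD; last exact: f_cont.
  apply: cvgM; first exact: cvg_cst.
  rewrite expr2; apply: cvgM; apply: cvg_norm; apply: cvgB => //; exact: cvg_cst.
have phi_inf : has_inf (phi @` C).
  split; first by exists (phi c), c.
  (* complete the square in |y - x| *)
  exists (a - 2^-1 * M ^+ 2) => _ [y _ <-]; rewrite /phi /prox_objective.
  have := f_ge y; have := sqr_ge0 (`|y - x| - M); nra.
pose I := inf (phi @` C).
have I_le y : C y -> I <= phi y.
  by move=> Cy; apply: ge_inf; [case: phi_inf | exists y].
pose S (e : R) := [set y | C y /\ phi y < I + e].
pose F := filter_from [set e : R | 0 < e] S.
have F_filter : Filter F.
  apply: filter_from_filter; first by exists 1 => /=.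
  move=> i j /= i_gt0 j_gt0; exists (Num.min i j) => /=.
    by rewrite lt_min i_gt0.
  by move=> y [Cy]; rewrite -ltrBlDl lt_min !ltrBlDl => /andP[? ?].
have F_proper : ProperFilter F.
  apply: filter_from_proper => e /= e_gt0.
  by have [_ [y Cy <-] ?] := inf_adherent e_gt0 phi_inf; exists y.
have F_S e : 0 < e -> F (S e) by move=> e_gt0; exists e.
have F_cauchy : cauchy F.
  apply: cauchy_exP => e e_gt0.
  (* at level e^2 / 8 the midpoint gain forces a distance below e *)
  have e2_gt0 : 0 < 8^-1 * e ^+ 2 by rewrite mulr_gt0 ?exprn_gt0.
  have [_ [y Cy <-] y_lt] := inf_adherent e2_gt0 phi_inf.
  exists y; apply: filterS (F_S _ e2_gt0) => z [Cz z_lt].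
  rewrite -ball_normE /ball_/=.
  have Cm : C (y + 2^-1 *: (z - y)) by apply: convex_set_segment => //; lra.
  have := prox_objective_midpoint x y z f_mid; have := I_le _ Cm.
  rewrite -/phi -/I in y_lt z_lt * => ? ?.
  rewrite -(@ltr_pXn2r _ 2)// ?nnegrE ?(ltW e_gt0)//.
  lra.
have /cvg_ex[/= p F_p] : cvg F by exact: cauchy_cvg.
exists p.
  apply: (closed_cvg (F := F) (u_ := id) C C_closed) => //.
  by apply: filterS (F_S 1 ltr01) => y [].
move=> q Cq; apply: le_trans (I_le q Cq).
apply/ler_addgt0Pl => e e_gt0; rewrite addrC.
apply: (cvgr_to_le (F := F) (f := phi)).
  exact: (cvg_comp _ _ F_p (phi_cont p)).
by apply: filterS (F_S e e_gt0) => y [_ /ltW].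
Qed.

(** The representative of L minimizes 1/2 |y|^2 - L y. *)
Lemma riesz_representation (L : {linear H -> R}) : continuous L ->
  exists v, forall u, L u = dot u v.
Proof.
move=> L_cont; have [k k_gt0 L_le] := linear_lipschitz L_cont.
have [||||||p _ p_min] := @prox_objective_argmin_ex
    (fun y => - L y) setT 0 0 k.
- by exists 0.
- exact: closedT.
- exact: convex_setT.
- move=> p q; rewrite linearD linearZ linearB/= /GRing.scale/=; lra.
- by move=> y; apply: cvgN; exact: L_cont.
- by move=> y; rewrite subr0 sub0r lerN2 (le_trans (ler_norm _)).
have le_dot h : L h <= dot h p.
  rewrite -subr_ge0; apply: (@ge0_of_quadratic_ge0 _ _ (2^-1 * `|h| ^+ 2)) => t _.
  have := p_min (p + t *: h) I; rewrite /prox_objective !subr0.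
  rewrite linearD linearZ/= /GRing.scale/= -!dot_norm !dotE (dotC p h).
  nra.
exists p => h; apply/le_anti/andP; split; first exact: le_dot.
by have := le_dot (- h); rewrite linearN dotNl lerN2.
Qed.

(** * Smooth convex functions *)

(** The quadratic bracket satisfied by a convex f whose gradient G is b-Lipschitz.
Being closed under nonnegative scaling and satisfied by f = 0 and b = 0, it
covers kappa g and the projection at once, with no derivative in sight. *)
Definition smooth_convex f G (b : R) := forall x y,
  f x + dot (G x) (y - x) <= f y
  <= f x + dot (G x) (y - x) + b / 2 * `|y - x| ^+ 2.

Lemma smooth_convexZ f G b (k : R) : 0 <= k -> smooth_convex f G b ->
  smooth_convex (fun y => k * f y) (fun y => k *: G y) (k * b).
Proof.
move=> k_ge0 fG x y; have /andP[lo up] := fG x y.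
rewrite dotZl -mulrDr ler_wpM2l//=.
rewrite (le_trans (ler_wpM2l k_ge0 up))// mulrDr !mulrA//.
Qed.

Lemma smooth_convex_midpoint f G b : smooth_convex f G b -> midpoint_convex f.
Proof.
move=> fG p q; set m := p + _.
have /andP[+ _] := fG m p; have /andP[+ _] := fG m q.
have -> : p - m = - (2^-1 *: (q - p)) by rewrite /m opprD addrA subrr sub0r.
have -> : q - m = 2^-1 *: (q - p).
  by rewrite /m opprD addrA -[X in X - _]scale1r -scalerBl; congr (_ *: _); field.
rewrite dotNr.
lra.
Qed.

Lemma smooth_convex_argmin_ex f G b C x :
  smooth_convex f G b -> continuous f -> C !=set0 -> closed C -> convex_set C ->
  exists2 p, C p & forall q, C q -> prox_objective f x p <= prox_objective f x q.
Proof.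
move=> fG f_cont C_neq0 C_closed C_convex.
apply: (prox_objective_argmin_ex (a := f x) (M := `|G x|)) => //.
  exact: smooth_convex_midpoint fG.
move=> y; have /andP[+ _] := fG x y; apply: le_trans.
have := dot_le_norm (- G x) (y - x).
by rewrite normrN dotNl lerD2l lerNl.
Qed.

(** The variational inequality that characterizes p as the projection of z
onto C, when C is convex. *)
Definition is_proj C z p := C p /\ forall q, C q -> dot (q - p) (z - p) <= 0.

(** The first-order optimality condition, in the form of a projection: moving
from p towards q by a fraction t changes the objective by at most
- t <q - p, x - G p - p> + t^2 (1 + b)/2 |q - p|^2. *)
Lemma argmin_is_proj f G b C x p :
  smooth_convex f G b -> convex_set C -> C p ->
  (forall q, C q -> prox_objective f x p <= prox_objective f x q) ->
  is_proj C (x - G p) p.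
Proof.
move=> fG C_convex Cp p_min; split=> // q Cq; rewrite -oppr_ge0.
apply: (@ge0_of_quadratic_ge0 _ _ ((1 + b) / 2 * `|q - p| ^+ 2)).
move=> t /andP[t_gt0 t_le1].
have t01 : 0 <= t <= 1 by rewrite ltW.
have := p_min _ (convex_set_segment C_convex Cp Cq t01).
have /andP[_ +] := fG p (p + t *: (q - p)).
rewrite /prox_objective [p + _ - p]addrC addKr.
rewrite -!dot_norm.
rewrite !dotE (dotC x p) (dotC x q) (dotC p q).
rewrite (dotC q (G p)) (dotC p (G p)).
nra.
Qed.

(** The projection is the case f = 0 of the previous results. *)
Lemma proj_is_proj C z : C !=set0 -> closed C -> convex_set C ->
  is_proj C z (proj C z).
Proof.
move=> C_neq0 C_closed C_convex.
have zero_smooth : smooth_convex (fun=> 0) (fun=> 0) 0.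
  by move=> x y; rewrite (linear0l dot) !add0r mul0r mul0r lexx.
have cst_cont : continuous (fun _ : H => 0 : R) by move=> ?; exact: cvg_cst.
have [p Cp p_min] := smooth_convex_argmin_ex z zero_smooth cst_cont
  C_neq0 C_closed C_convex.
have [|Cproj proj_min] := @xgetPex _ (0 : H)
    [set p | C p /\ forall q, C q -> `|z - p| <= `|z - q|].
  exists p; split=> // q Cq; rewrite distrC [leRHS]distrC.
  have := p_min _ Cq; rewrite /prox_objective !addr0.
  by rewrite ler_pM2l// ler_pXn2r ?nnegrE.
have := @argmin_is_proj (fun=> 0) (fun=> 0) 0 C z (proj C z) zero_smooth
  C_convex Cproj.
rewrite subr0; apply=> q Cq; rewrite /prox_objective !addr0 ler_pM2l//.
by rewrite ler_pXn2r ?nnegrE// distrC [leRHS]distrC; exact: proj_min.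
Qed.

(** Baillon-Haddad.  The function f - <G u, .> is minimal at u, and the upper
half of the bracket at v shows that one gradient step from v makes it drop by
|G v - G u|^2 / (2 b); adding the inequality so obtained to the one with u and
v exchanged gives the claim. *)
Lemma gradient_cocoercive f G b x y : 0 < b -> smooth_convex f G b ->
  `|G y - G x| ^+ 2 <= b * dot (G y - G x) (y - x).
Proof.
move=> b_gt0 fG.
have half u v : f u + dot (G u) (v - u) + (2 * b)^-1 * `|G v - G u| ^+ 2 <= f v.
  (* w is the gradient step of length 1 / b *)
  set d := G v - G u; pose w := v - b^-1 *: d.
  have /andP[+ _] := fG u w; have /andP[_ +] := fG v w.
  have -> : w - v = - (b^-1 *: d) by rewrite /w addrC addKr.
  have -> : w - u = (v - u) - b^-1 *: d by rewrite /w addrAC.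
  rewrite normrN normrZ gtr0_norm ?invr_gt0// exprMn.
  have -> : b / 2 * (b^-1 ^+ 2 * `|d| ^+ 2) = b^-1 / 2 * `|d| ^+ 2.
    by field; rewrite gt_eqF.
  have : `|d| ^+ 2 = dot (G v) d - dot (G u) d.
    by rewrite -dot_norm [in LHS]/d dotDl dotNl.
  rewrite invfM (dotDr _ (v - u)) !(dotNr _ (_ *: _)) !dotZr.
  move=> d2 up lo.
  have : b^-1 * `|d| ^+ 2 = b^-1 * (dot (G v) d - dot (G u) d) by rewrite d2.
  lra.
have := half x y; have := half y x; rewrite (distrC (G x)) invfM => yx xy.
rewrite -(@ler_pM2l _ b^-1) ?invr_gt0// mulKf ?gt_eqF//.
have : dot (G y - G x) (y - x) = - dot (G x) (y - x) - dot (G y) (x - y).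
  by rewrite !dotE; ring.
lra.
Qed.

(** Expanding the square, the cross term - 2 s <d, h>, with d = G y - G x and
h = y - x, absorbs s^2 |d|^2 by cocoercivity. *)
Lemma forward_step_nonexpansive f G b (s : R) x y :
  0 < b -> smooth_convex f G b -> 0 <= s -> s * b <= 2 ->
  `|(y - s *: G y) - (x - s *: G x)| <= `|y - x|.
Proof.
move=> b_gt0 fG s_ge0 sb_le2.
have := gradient_cocoercive x y b_gt0 fG.
set d := G y - G x; set h := y - x => coco.
have -> : (y - s *: G y) - (x - s *: G x) = h - s *: d.
  by rewrite /h /d scalerBr !opprB addrACA [RHS]addrACA [- x - _]addrC.
clearbody d h.
rewrite -(@ler_pXn2r _ 2)// ?nnegrE//.
rewrite -[X in X <= _]dot_norm !dotE !dot_norm (dotC h d).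
have d_ge0 : 0 <= dot d h.
  by rewrite -(pmulr_rge0 _ b_gt0) (le_trans _ coco)// sqr_ge0.
have : s * `|d| ^+ 2 <= 2 * dot d h.
  apply: le_trans (ler_wpM2l s_ge0 coco) _.
  by rewrite mulrA ler_wpM2r.
move/(ler_wpM2l s_ge0).
lra.
Qed.

(** Add the variational inequality of P tested at p, multiplied by 1 + s, to that
of p tested at P, multiplied by s: x cancels, and what remains is
(1 + s) |P - p|^2 <= <P - p, (y - s G y) - (p - s G p)>.  The factor 1 + s
comes from the quadratic term of the objective, treated implicitly. *)
Lemma forward_backward_contraction f G b C (s : R) x p y P :
  0 < b -> smooth_convex f G b -> 0 < s -> s * b <= 2 ->
  is_proj C (x - G p) p ->
  is_proj C ((1 + s)^-1 *: (y - s *: (G y - x))) P ->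
  `|P - p| <= (1 + s)^-1 * `|y - p|.
Proof.
move=> b_gt0 fG s_gt0 sb_le2 [Cp p_ineq] [CP P_ineq].
have s1_gt0 : 0 < 1 + s by lra.
rewrite ler_pdivlMl//.
have [->|P_neq_p] := eqVneq P p; first by rewrite subrr normr0 mulr0.
have Pp_gt0 : 0 < `|P - p| by rewrite normr_gt0 subr_eq0.
rewrite -(ler_pM2r Pp_gt0) -mulrA -expr2.
set a := (y - s *: G y) - (p - s *: G p).
have a_le : `|a| <= `|y - p|.
  exact: forward_step_nonexpansive b_gt0 fG (ltW s_gt0) sb_le2.
have := dot_le_norm (P - p) a.
have : `|P - p| * `|a| <= `|P - p| * `|y - p| by rewrite ler_pM2l.
have := P_ineq _ Cp; have := p_ineq _ CP.
rewrite [`|y - p| * _]mulrC.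
suff : (1 + s) * `|P - p| ^+ 2 = dot (P - p) a + s * dot (P - p) (x - G p - p)
   + (1 + s) * dot (p - P) ((1 + s)^-1 *: (y - s *: (G y - x)) - P) by nra.
rewrite (dotDr (p - P)) dotZr mulrDr mulVKf ?gt_eqF//.
rewrite -dot_norm /a !dotE (dotC P p).
ring.
Qed.

(** * From differentiability to the quadratic bracket *)

(** With h = y - x, the function
psi t = f(x + t h) - t <G x, h> - b/2 |h|^2 t^2 is nonincreasing on [0, 1],
since |G(x + t h) - G x| <= b t |h|; compare psi 1 with psi 0. *)
Lemma descent_lemma f G (b : R) x y :
  (forall z, differentiable f z) -> (forall z h, 'd f z h = dot h (G z)) ->
  (forall u v, `|G u - G v| <= b * `|u - v|) ->
  f y <= f x + dot (G x) (y - x) + b / 2 * `|y - x| ^+ 2.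
Proof.
move=> f_diff f_grad G_lip; pose h := y - x.
pose psi t := f (x + t *: h) - t * dot (G x) h - b / 2 * `|h| ^+ 2 * t ^+ 2.
have psi_derive (t : R) : is_derive t 1 psi
    (dot h (G (x + t *: h)) - dot (G x) h - b * `|h| ^+ 2 * t).
  have ? := is_derive_along_line (f_diff (x + t *: h)).
  apply: is_derive_eq.
  by rewrite f_grad; set Gh := dot h _; rewrite /GRing.scale/=; field.
have psi_le0 (t : R) : t \in `]0, 1[ -> (psi^`())%classic t <= 0.
  rewrite in_itv/= => /andP[t_gt0 _]; rewrite derive1E derive_val.
  rewrite (dotC (G x)) -dotNr -dotDr.
  have := dot_le_norm h (G (x + t *: h) - G x).
  have := G_lip (x + t *: h) x; rewrite [x + _]addrC addrK normrZ gtr0_norm//.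
  move=> /(ler_wpM2l (normr_ge0 h)).
  lra.
have psi_derivable (t : R) : derivable psi t 1 by exact: ex_derive.
have psi_cont : {within `[0, 1], continuous psi}.
  by apply: derivable_within_continuous => t _.
have : psi 1 <= psi 0.
  by apply: (ler0_derive1_le_cc _ psi_le0 psi_cont); rewrite ?in_itv/= ?lexx ?ler01.
rewrite /psi scale1r scale0r addr0 /h [x + _]addrC subrK.
rewrite !mul0r expr0n/= mulr0 expr1n mulr1 mul1r !subr0.
lra.
Qed.

(** The Riesz theorem makes the set from which the gradient is chosen nonempty. *)
Lemma gradientP (g : H -> \bar R) z : ediff_at g z ->
  forall h, 'd (fine \o g) z h = dot h (gradient dot g z).
Proof.
move=> [_ g_diff].
have [v grad_v] := riesz_representation (diff_continuous g_diff).
have grad_ex : exists v, [set v | forall u, 'd (fine \o g) z u = dot u v] v.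
  by exists v.
exact: (xgetPex 0 grad_ex).
Qed.

Lemma smooth_convex_fine (g : H -> \bar R) (b : R) :
  econvex g -> (forall z, ediff_at g z) -> b.-lipschitz (gradient dot g) ->
  smooth_convex (fine \o g) (gradient dot g) b.
Proof.
move=> g_conv g_diff g_lip x y.
have g_fin z : g z = (fine (g z))%:E.
  by have [/nbhs_singleton g_fin _] := g_diff z; rewrite fineK.
have G_lip u v : `|gradient dot g u - gradient dot g v| <= b * `|u - v|.
  exact: (g_lip (u, v)).
apply/andP; split; last first.
  apply: descent_lemma => // z; [by have [] := g_diff z | exact: gradientP].
rewrite dotC -gradientP//; apply: convex_above_tangent; last first.
  by have [] := g_diff x.
move=> t t01; have := g_conv y x t t01.
rewrite (g_fin (_ + _)) (g_fin y) (g_fin x).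
by rewrite -!EFinM -EFinD lee_fin.
Qed.

(** * Proximal points and the relaxed iteration *)

(** This trades extended real values for a constraint: as C is nonempty, a
minimizer has a finite value and hence lies in C. *)
Lemma argmin_constrainedP f C x p : C !=set0 ->
  argmin (fun y => (2^-1 * `|y - x| ^+ 2)%:E + (indicator C y + (f y)%:E))%E p
  <-> C p /\ forall q, C q -> prox_objective f x p <= prox_objective f x q.
Proof.
move=> [c Cc].
have objE y : C y -> ((2^-1 * `|y - x| ^+ 2)%:E + (indicator C y + (f y)%:E))%E =
    (prox_objective f x y)%:E.
  by move=> Cy; rewrite /indicator asboolT// add0e -EFinD.
have objNE y : ~ C y ->
    ((2^-1 * `|y - x| ^+ 2)%:E + (indicator C y + (f y)%:E))%E = +oo%E.
  by move=> Cy; rewrite /indicator asboolF.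
split=> [p_min|[Cp p_min] q].
  have Cp : C p.
    apply: contrapT => nCp; have := p_min c.
    by rewrite objNE// objE.
  by split=> // q Cq; have := p_min q; rewrite !objE// lee_fin.
have [Cq|nCq] := pselect (C q); first by rewrite !objE// lee_fin p_min.
by rewrite (objNE q)// leey.
Qed.

Lemma smooth_convex_prox f G (b : R) (C : set H) x :
  continuous f -> smooth_convex f G b ->
  C !=set0 -> closed C -> convex_set C ->
  let p := prox (fun y => indicator C y + (f y)%:E)%E x in
  C p /\ forall q, C q -> prox_objective f x p <= prox_objective f x q.
Proof.
move=> f_cont fG C_neq0 C_closed C_convex p; apply/argmin_constrainedP => //.
have [q Cq q_min] := smooth_convex_argmin_ex x fG f_cont
  C_neq0 C_closed C_convex.
apply: xgetPex; exists q; exact/argmin_constrainedP.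
Qed.

End InnerProduct.

(** The factor is the convex combination 1 - l + l / (1 + s) = 1 - l s / (1 + s),
which decreases in l and in s, so the lower bounds l0 and s0 give the worst
case. *)
Lemma relaxed_contraction (R : realType) (H : normedModType R)
    (l0 l s0 s : R) (y p P : H) :
  0 <= l0 -> l0 <= l -> l <= 1 -> 0 < s0 -> s0 <= s ->
  `|P - p| <= (1 + s)^-1 * `|y - p| ->
  `|y + l *: (P - y) - p| <= (1 - l0 * s0 / (1 + s0)) * `|y - p|.
Proof.
move=> l0_ge0 l0_le l_le1 s0_gt0 s0_le P_le.
have l_ge0 : 0 <= l by lra.
have -> : y + l *: (P - y) - p = (1 - l) *: (y - p) + l *: (P - p).
  have -> : P - y = (P - p) - (y - p) by rewrite opprB addrA subrK.
  by rewrite scalerBr scalerBl scale1r addrAC addrA addrAC.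
apply: le_trans (ler_normD _ _) _; rewrite !normrZ !ger0_norm ?subr_ge0//.
apply: (@le_trans _ _ ((1 - l * (1 - (1 + s)^-1)) * `|y - p|)).
  by move: l_ge0 => /ler_wpM2l /(_ _ _ P_le); lra.
apply: ler_wpM2r => //; rewrite lerD2l lerN2 -mulrA.
have -> : s0 / (1 + s0) = 1 - (1 + s0)^-1 by field; rewrite gt_eqF; lra.
have inv_le : (1 + s)^-1 <= (1 + s0)^-1 by rewrite lef_pV2 ?posrE; lra.
have inv_le1 : (1 + s0)^-1 <= 1 by rewrite invf_le1; lra.
by apply: ler_pM; lra.
Qed.

Theorem proposition3p3 (R : realType) (H : completeNormedModType R)
    (dot : {dot H for @idfun R})
    (dot_norm : forall u : H, dot u u = `|u| ^+ 2)
    (sepH : separable_space H)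
    (C : set H) (C_neq0 : C !=set0) (C_closed : closed C)
    (C_convex : convex_set C)
    (kappa : R) (kappa_gt0 : 0 < kappa)
    (g : H -> \bar R) (g_Gamma0 : Gamma0 g)
    (g_diff : forall z : H, ediff_at g z)
    (beta : R) (beta_gt0 : 0 < beta)
    (g_lip : beta.-lipschitz (gradient dot g))
    (gamma : nat -> R) (gamma_lo gamma_hi : R)
    (gamma_lo_gt0 : 0 < gamma_lo)
    (gamma_bnd : forall n, gamma_lo <= gamma n <= gamma_hi)
    (gamma_hi_lt : gamma_hi < 2 * kappa^-1 * beta^-1)
    (lambda : nat -> R) (lambda_lo : R)
    (lambda_lo_gt0 : 0 < lambda_lo)
    (lambda_bnd : forall n, lambda_lo <= lambda n <= 1)
    (x x0 : H) (xs : nat -> H)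
    (xs0 : xs 0%N = x0)
    (xsS : forall n, xs n.+1 = xs n + lambda n *:
       (proj C ((1 + gamma n)^-1 *:
                (xs n - gamma n *: (kappa *: gradient dot g (xs n) - x)))
        - xs n)) :
  let kg := (fun y => kappa%:E * g y)%E in
  let p := prox (fun y => indicator C y + kg y)%E x in
  let rho := 1 - lambda_lo * gamma_lo / (1 + gamma_lo) in
  (forall n, `|xs n - p| <= rho ^+ n * `|x0 - p|)
  /\
  (x0 = prox kg x -> C (prox kg x) -> forall n, xs n = p).
Proof.
move=> kg p rho.
pose f y := kappa * fine (g y); pose G y := kappa *: gradient dot g y.
have kgE : kg = EFin \o f.
  apply/funext => y; have [/nbhs_singleton g_fin _] := g_diff y.
  by rewrite /kg /f /= EFinM fineK.
have fG : smooth_convex dot f G (kappa * beta).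
  apply: smooth_convexZ (ltW kappa_gt0) _.
  by apply: smooth_convex_fine => //; case: g_Gamma0.
have f_cont : continuous f.
  move=> y; apply: cvgM; first exact: cvg_cst.
  by apply: differentiable_continuous; have [] := g_diff y.
have kb_gt0 : 0 < kappa * beta by rewrite mulr_gt0.
have [Cp p_min] : C p /\
    forall q, C q -> prox_objective f x p <= prox_objective f x q.
  by rewrite /p kgE; exact: smooth_convex_prox f_cont fG _ _ _.
have p_proj : is_proj dot C (x - G p) p by exact: argmin_is_proj fG _ _ p_min.
have step n : `|xs n.+1 - p| <= rho * `|xs n - p|.
  have /andP[gamma_ge gamma_le] := gamma_bnd n.
  have /andP[lambda_ge lambda_le] := lambda_bnd n.
  have gamma_gt0 : 0 < gamma n by lra.
  have gb_le2 : gamma n * (kappa * beta) <= 2.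
    have /ltW := le_lt_trans gamma_le gamma_hi_lt.
    by rewrite -mulrA -invfM ler_pdivlMr.
  have := forward_backward_contraction dot_norm kb_gt0 fG gamma_gt0 gb_le2 p_proj
    (proj_is_proj dot_norm _ C_neq0 C_closed C_convex : is_proj _ _
       ((1 + gamma n)^-1 *: (xs n - gamma n *: (G (xs n) - x))) _).
  set P := proj _ _ => P_le.
  rewrite xsS -/P.
  exact: relaxed_contraction (ltW lambda_lo_gt0) lambda_ge lambda_le gamma_lo_gt0
    gamma_ge P_le.
have rho_ge0 : 0 <= rho.
  have /andP[lambda_ge lambda_le] := lambda_bnd 0.
  rewrite subr_ge0 ler_pdivrMr; last by lra.
  by rewrite mul1r; nra.
have rate n : `|xs n - p| <= rho ^+ n * `|x0 - p|.
  elim: n => [|n IHn]; first by rewrite xs0 expr0 mul1r.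
  by rewrite (le_trans (step n))// exprS -mulrA ler_wpM2l.
split=> // x0E Cq n.
suff x0p : x0 = p.
  have := rate n; rewrite x0p subrr normr0 mulr0 normr_le0 subr_eq0.
  by move/eqP.
rewrite x0E; have setT0 : [set: H] !=set0 by exists 0.
have := smooth_convex_prox dot_norm x f_cont fG setT0 closedT (@convex_setT R H).
have -> : (fun y => indicator setT y + (f y)%:E)%E = kg.
  by rewrite kgE; apply/funext => y; rewrite /indicator asboolT// add0e.
move=> [_ q_min].
apply: (prox_objective_argmin_unique dot_norm (smooth_convex_midpoint fG) C_convex
  Cq _ Cp p_min) => y _.
exact: q_min.
Qed.
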